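(* (Preservation, reaching definitions.) Let $P$ be a program, let $\Rightarrow$ be the reaching-definitions augmented execution relation of $P$ and $\rightarrow$ the standard execution relation of $P$. For all labels $l,l'$, states $\sigma,\sigma'$ and functions $\pi,\pi':V\to\mathcal{P}(L)$: if $\langle l,\sigma,\pi\rangle\Rightarrow\langle l',\sigma',\pi'\rangle$, then $\langle l,\sigma\rangle\rightarrow\langle l',\sigma'\rangle$.
   Context: Language. $N$ is the set of integers, $T=\{\mathbf{true},\mathbf{false}\}$, $V$ a set of variables, $L$ a set of labels. Arithmetic expressions $E$: $e::=n\mid v\mid e_0+e_1\mid e_0-e_1\mid e_0\times e_1$ ($n\in N$, $v\in V$). Boolean expressions $B$: $b::=\mathbf{true}\mid\mathbf{false}\mid e_0=e_1\mid e_0\le e_1\mid\mathbf{not}\,b\mid b_0\,\mathbf{and}\,b_1\mid b_0\,\mathbf{or}\,b_1$. Commands: $c::=\mathbf{skip}\mid v:=e\mid\mathbf{if}\,b\,\mathbf{then}\,g\mid\mathbf{goto}\,g\mid\mathbf{halt}\mid\mathbf{done}$ ($g\in L$). A program $P$ is a sequence of labeled commands $l:c$ with pairwise distinct labels; $\mathbf{next}(l)$ is the label of the command following $l$ in the sequence. If $l:\mathbf{halt}\in P$ then $\mathbf{next}(l):\mathbf{done}\in P$. Branch targets $g$, and $\mathbf{next}(l)$ for each assignment, $\mathbf{skip}$, $\mathbf{if}$ or $\mathbf{halt}$ command at $l$, are labels of $P$. Standard semantics. A state is a partial function $\sigma:V\rightharpoonup N$ with domain $\mathrm{dom}\,\sigma$.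 The evaluation relations $\langle e,\sigma\rangle\rightarrow n$ and $\langle b,\sigma\rangle\rightarrow t$ are the least relations with: constants evaluate to themselves; $\langle v,\sigma\rangle\rightarrow\sigma(v)$ if $v\in\mathrm{dom}\,\sigma$; a compound expression evaluates to the result of applying its operator to the values of all of its immediate subexpressions, provided all of these evaluate (no short-circuiting). The relation $\langle l,\sigma\rangle\rightarrow\langle l',\sigma'\rangle$ is the least relation with: if $l:v:=e\in P$ and $\langle e,\sigma\rangle\rightarrow n$, then $\langle l,\sigma\rangle\rightarrow\langle\mathbf{next}(l),\sigma[v\mapsto n]\rangle$; if $l:\mathbf{if}\,b\,\mathbf{then}\,g\in P$, then $\langle l,\sigma\rangle\rightarrow\langle g,\sigma\rangle$ when $\langle b,\sigma\rangle\rightarrow\mathbf{true}$ and $\langle l,\sigma\rangle\rightarrow\langle\mathbf{next}(l),\sigma\rangle$ when $\langle b,\sigma\rangle\rightarrow\mathbf{false}$; if $l:\mathbf{goto}\,g\in P$, then $\langle l,\sigma\rangle\rightarrow\langle g,\sigma\rangle$; if $l:\mathbf{skip}\in P$, or $l:\mathbf{halt}\in P$ and $\mathbf{next}(l):\mathbf{done}\in P$, then $\langle l,\sigma\rangle\rightarrow\langle\mathbf{next}(l),\sigma\rangle$. Reaching-definitions augmented semantics. The history variable is a function $\pi:V\to\mathcal{P}(L)$; these are ordered by $\pi_1\le\pi_2$ iff $\pi_1(v)\subseteq\pi_2(v)$ for all $v\in V$. Evaluation $\langle e,\sigma,\pi\rangle\Rightarrow n$, $\langle b,\sigma,\pi\rangle\Rightarrow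 t$ is defined by exactly the standard rules with $\pi$ carried along unchanged. The relation $\langle l,\sigma,\pi\rangle\Rightarrow\langle l',\sigma',\pi'\rangle$ is the least relation with: if $l:v:=e\in P$ and $\langle e,\sigma,\pi\rangle\Rightarrow n$, then $\langle l,\sigma,\pi\rangle\Rightarrow\langle\mathbf{next}(l),\sigma[v\mapsto n],\pi[v\mapsto\{l\}]\rangle$; for $\mathbf{if}$, $\mathbf{goto}$, $\mathbf{skip}$, $\mathbf{halt}$ the rules are the standard ones with evaluation $\Rightarrow$ in place of $\rightarrow$ and $\pi$ passed through unchanged; and (upward closure) if $\langle l,\sigma,\pi\rangle\Rightarrow\langle l',\sigma',\pi'\rangle$ and $\pi'\le\pi''$, then $\langle l,\sigma,\pi\rangle\Rightarrow\langle l',\sigma',\pi''\rangle$. *)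

(* Defs.v *)
From HB Require Import structures.
From mathcomp Require Import all_boot all_order all_algebra.
From mathcomp Require Import boolp classical_sets.

Set Implicit Arguments.
Unset Strict Implicit.
Unset Printing Implicit Defensive.

Local Open Scope ring_scope.

Inductive aexp (V : Type) : Type :=
| ANum of int
| AVar of V
| AAdd of aexp V & aexp V
| ASub of aexp V & aexp V
| AMul of aexp V & aexp V.
Arguments ANum {V} _.

Inductive bexp (V : Type) : Type :=
| BTrue
| BFalse
| BEq of aexp V & aexp V
| BLe of aexp V & aexp V
| BNot of bexp V
| BAnd of bexp V & bexp V
| BOr of bexp V & bexp V.
Arguments BTrue {V}.
Arguments BFalse {V}.

Inductive cmd (V L : Type) : Type :=
| CSkip
| CAssign of V & aexp V
| CIf of bexp V & L
| CGoto of L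
| CHalt
| CDone.
Arguments CSkip {V L}.
Arguments CAssign {V L} _ _.
Arguments CIf {V L} _ _.
Arguments CGoto {V L} _.
Arguments CHalt {V L}.
Arguments CDone {V L}.

(* Classical decidable equality; it serves only to write [(l, c) \in P]. *)
HB.instance Definition _ (V L : Type) := gen_eqMixin (cmd V L).

(* [None] when l labels no command, or labels the last one. *)
Definition next_label (V : Type) (L : eqType) (P : seq (L * cmd V L)) (l : L) :
    option L :=
  onth (unzip1 P) (index l (unzip1 P)).+1.

Definition falls_through (V L : Type) (c : cmd V L) : bool :=
  match c with
  | CSkip | CAssign _ _ | CIf _ _ | CHalt => true
  | CGoto _ | CDone => false
  end.

Definition target (V L : Type) (c : cmd V L) : option L :=
  match c with
  | CIf _ g | CGoto g => Some g
  | CSkip | CAssign _ _ | CHalt | CDone => None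
  end.

Record program (V L : eqType) := Program {
  code :> seq (L * cmd V L);
  labels_uniq : uniq (unzip1 code);
  halt_done : forall l, (l, CHalt) \in code ->
    exists2 l', next_label code l = Some l' & (l', CDone) \in code;
  target_label : forall l c g, (l, c) \in code -> target c = Some g ->
    g \in unzip1 code;
  falls_through_label : forall l c, (l, c) \in code -> falls_through c ->
    exists2 l', next_label code l = Some l' & l' \in unzip1 code
}.

(* Partial functions; [None] means "outside the domain". *)
Definition state (V : Type) := V -> option int.

Section Evaluation.
Variable V : Type.

Inductive aeval (s : state V) : aexp V -> int -> Prop :=
| aeval_num n : aeval s (ANum n) n
| aeval_var v n : s v = Some n -> aeval s (AVar v) n
| aeval_add e0 e1 n0 n1 : aeval s e0 n0 -> aeval s e1 n1 ->
    aeval s (AAdd e0 e1) (n0 + n1)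
| aeval_sub e0 e1 n0 n1 : aeval s e0 n0 -> aeval s e1 n1 ->
    aeval s (ASub e0 e1) (n0 - n1)
| aeval_mul e0 e1 n0 n1 : aeval s e0 n0 -> aeval s e1 n1 ->
    aeval s (AMul e0 e1) (n0 * n1).

Inductive beval (s : state V) : bexp V -> bool -> Prop :=
| beval_true : beval s BTrue true
| beval_false : beval s BFalse false
| beval_eq e0 e1 n0 n1 : aeval s e0 n0 -> aeval s e1 n1 ->
    beval s (BEq e0 e1) (n0 == n1)
| beval_le e0 e1 n0 n1 : aeval s e0 n0 -> aeval s e1 n1 ->
    beval s (BLe e0 e1) (n0 <= n1)
| beval_not b t : beval s b t -> beval s (BNot b) (~~ t)
| beval_and b0 b1 t0 t1 : beval s b0 t0 -> beval s b1 t1 ->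
    beval s (BAnd b0 b1) (t0 && t1)
| beval_or b0 b1 t0 t1 : beval s b0 t0 -> beval s b1 t1 ->
    beval s (BOr b0 b1) (t0 || t1).

End Evaluation.

Inductive step (V L : eqType) (P : program V L) :
    L -> state V -> L -> state V -> Prop :=
| step_assign l l' v e n s :
    (l, CAssign v e) \in code P -> aeval s e n -> next_label P l = Some l' ->
    step P l s l' [eta s with v |-> Some n]
| step_if_true l b g s :
    (l, CIf b g) \in code P -> beval s b true -> step P l s g s
| step_if_false l l' b g s :
    (l, CIf b g) \in code P -> beval s b false -> next_label P l = Some l' ->
    step P l s l' s
| step_goto l g s :
    (l, CGoto g) \in code P -> step P l s g s
| step_skip l l' s :
    (l, CSkip) \in code P -> next_label P l = Some l' -> step P l s l' s
| step_halt l l' s :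
    (l, CHalt) \in code P -> next_label P l = Some l' -> (l', CDone) \in code P ->
    step P l s l' s.

Definition history (V L : Type) := V -> set L.

Definition history_le (V L : Type) (p1 p2 : history V L) : Prop :=
  forall v, (p1 v `<=` p2 v)%classic.

Section AugmentedEvaluation.
Variables V L : Type.

Inductive rd_aeval (s : state V) (p : history V L) : aexp V -> int -> Prop :=
| rd_aeval_num n : rd_aeval s p (ANum n) n
| rd_aeval_var v n : s v = Some n -> rd_aeval s p (AVar v) n
| rd_aeval_add e0 e1 n0 n1 : rd_aeval s p e0 n0 -> rd_aeval s p e1 n1 ->
    rd_aeval s p (AAdd e0 e1) (n0 + n1)
| rd_aeval_sub e0 e1 n0 n1 : rd_aeval s p e0 n0 -> rd_aeval s p e1 n1 ->
    rd_aeval s p (ASub e0 e1) (n0 - n1)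
| rd_aeval_mul e0 e1 n0 n1 : rd_aeval s p e0 n0 -> rd_aeval s p e1 n1 ->
    rd_aeval s p (AMul e0 e1) (n0 * n1).

Inductive rd_beval (s : state V) (p : history V L) : bexp V -> bool -> Prop :=
| rd_beval_true : rd_beval s p BTrue true
| rd_beval_false : rd_beval s p BFalse false
| rd_beval_eq e0 e1 n0 n1 : rd_aeval s p e0 n0 -> rd_aeval s p e1 n1 ->
    rd_beval s p (BEq e0 e1) (n0 == n1)
| rd_beval_le e0 e1 n0 n1 : rd_aeval s p e0 n0 -> rd_aeval s p e1 n1 ->
    rd_beval s p (BLe e0 e1) (n0 <= n1)
| rd_beval_not b t : rd_beval s p b t -> rd_beval s p (BNot b) (~~ t)
| rd_beval_and b0 b1 t0 t1 : rd_beval s p b0 t0 -> rd_beval s p b1 t1 ->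
    rd_beval s p (BAnd b0 b1) (t0 && t1)
| rd_beval_or b0 b1 t0 t1 : rd_beval s p b0 t0 -> rd_beval s p b1 t1 ->
    rd_beval s p (BOr b0 b1) (t0 || t1).

End AugmentedEvaluation.

Inductive rd_step (V L : eqType) (P : program V L) :
    L -> state V -> history V L -> L -> state V -> history V L -> Prop :=
| rd_step_assign l l' v e n s p :
    (l, CAssign v e) \in code P -> rd_aeval s p e n -> next_label P l = Some l' ->
    rd_step P l s p
      l' [eta s with v |-> Some n] [eta p with v |-> [set l]%classic]
| rd_step_if_true l b g s p :
    (l, CIf b g) \in code P -> rd_beval s p b true -> rd_step P l s p g s p
| rd_step_if_false l l' b g s p :
    (l, CIf b g) \in code P -> rd_beval s p b false -> next_label P l = Some l' ->
    rd_step P l s p l' s p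
| rd_step_goto l g s p :
    (l, CGoto g) \in code P -> rd_step P l s p g s p
| rd_step_skip l l' s p :
    (l, CSkip) \in code P -> next_label P l = Some l' -> rd_step P l s p l' s p
| rd_step_halt l l' s p :
    (l, CHalt) \in code P -> next_label P l = Some l' -> (l', CDone) \in code P ->
    rd_step P l s p l' s p
| rd_step_up l l' s s' p p' p'' :
    rd_step P l s p l' s' p' -> history_le p' p'' ->
    rd_step P l s p l' s' p''.

(* Main.v *)
Require Import Defs.
From mathcomp Require Import all_boot.

(** No evaluation or command rule tests the history, so erasing it turns each such augmented rule
    into its standard counterpart. Upward closure alters only the history and erases to a trivial
    step. Induction on derivations, for expressions and then for [rd_step], makes this precise. *)

Lemma rd_aeval_aeval {V L : Type} {s : state V} {p : history V L} {e n} :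
  rd_aeval s p e n -> aeval s e n.
Proof. by elim=> *; constructor. Qed.

Lemma rd_beval_beval {V L : Type} {s : state V} {p : history V L} {b t} :
  rd_beval s p b t -> beval s b t.
Proof. by elim=> *; constructor; try apply: rd_aeval_aeval; eassumption. Qed.

Theorem theorem5p7 (V L : eqType) (P : program V L) (l l' : L)
    (s s' : state V) (p p' : history V L) :
  rd_step P l s p l' s' p' -> step P l s l' s'.
Proof.
(* Here [//] settles [rd_step_up]: its induction hypothesis is already the goal. *)
elim=> {l l' s s' p p'} //.
- move=> l l' v e n s p Pl /rd_aeval_aeval ev nl; exact: step_assign Pl ev nl.
- move=> l b g s p Pl /rd_beval_beval; exact: step_if_true Pl.
- move=> l l' b g s p Pl /rd_beval_beval; exact: step_if_false Pl.
- move=> l g s p; exact: step_goto.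
- move=> l l' s p; exact: step_skip.
- move=> l l' s p; exact: step_halt.
Qed.
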